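(* Let $n>2$ be an integer (odd or even) and $q\in\mathcal{B}_n$. If $f\in\mathcal{B}_n$ is (balanced and) $q$-nearly bent, then there exists a matrix $A_0\in GL_n$ such that $|W_q(f)(A_0)|=\rho_q$.
   Context: $V_n=\{0,1\}^n$ (row vectors) and $\mathcal{B}_n$ is the set of Boolean functions $V_n\to\{0,1\}$. $wt(f)=|\{a: f(a)=1\}|$; $f$ is balanced if $wt(f)=2^{n-1}$. $W(f,g)=\sum_{a\in V_n}(-1)^{f(a)+g(a)}$. $GL_n$ is the group of invertible $n\times n$ matrices over $\mathbb{F}_2$; $q_A(a)=q(aA)$; $W_q(f)(A)=W(f,q_A)$. $I_q=\sum_{a\in V_n}(-1)^{q(a)}$ and $\rho_q=\left\lceil\left(\frac{2^{2n}-I_q^2}{2^n-1}\right)^{1/2}\right\rceil$. A balanced $f\in\mathcal{B}_n$ is called $q$-nearly bent if $|W_q(f)(A)|\le\rho_q$ for all $A\in GL_n$. *)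

(* Defs.v *)
From HB Require Import structures.
From mathcomp Require Import all_boot all_order all_algebra.
From mathcomp Require Import reals.

Set Implicit Arguments.
Unset Strict Implicit.
Unset Printing Implicit Defensive.

Import Order.TTheory GRing.Theory Num.Theory.

Local Open Scope ring_scope.

Notation vec n := 'rV['F_2]_n.
Notation boolfun n := {ffun vec n -> bool}.

Section BooleanFunctions.
Variable n : nat.
Implicit Types (f g q : boolfun n) (A : 'M['F_2]_n).

Definition wt f : nat := #|[set a : vec n | f a]|.

Definition balanced f : Prop := wt f = (2 ^ (n - 1))%N.

(* The exponent is the natural-number sum of the bits, via bool >-> nat. *)
Definition walsh f g : int := \sum_(a : vec n) (-1) ^+ (f a + g a)%N.

Definition twist q A : boolfun n := [ffun a : vec n => q (a *m A)].

Definition qwalsh q f A : int := walsh f (twist q A).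

Definition imbalance q : int := \sum_(a : vec n) (-1) ^+ q a.

Definition rho (R : realType) q : int :=
  Num.ceil (Num.sqrt ((2 ^+ (2 * n) - (imbalance q)%:~R ^+ 2)
                      / (2 ^+ n - 1) : R)).

(* GL_n is the set of A \in unitmx, so that A keeps the type 'M_n for the
   given n instead of the 'M_n.-1.+1 underlying {'GL_n['F_2]}. *)
Definition nearly_bent (R : realType) q f : Prop :=
  balanced f /\ forall A, A \in unitmx -> `|qwalsh q f A| <= rho R q.

End BooleanFunctions.

(* Main.v *)
Require Import Defs.
From HB Require Import structures.
From mathcomp Require Import all_boot all_order all_algebra.
From mathcomp Require Import reals ring.

Set Implicit Arguments.
Unset Strict Implicit.
Unset Printing Implicit Defensive.

Import Order.TTheory GRing.Theory Num.Theory.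

Local Open Scope ring_scope.

(** The mean of [W_q(f)(A)^2] over [A] in [GL_n] is exactly
    [(2^(2n) - I_q^2) / (2^n - 1)], so some [|W_q(f)(A)|], being an integer, is
    at least the ceiling of its square root. The mean is computed by expanding
    the square: since distinct nonzero vectors over [F_2] are linearly
    independent, [GL_n] is transitive on pairs of them, and the correlation
    [sum_A (-1)^(q(aA) + q(bA))] depends only on which of [a = 0], [b = 0],
    [a = b] hold. *)

(** Gaussian elimination writes a row-free [Z] as [C *m row_mx 1 0 *m E] with [C], [E] invertible.
    The witness undoes [E] of [X], corrects [C] by the block [D], and applies [E] of [Y]. *)
Lemma row_free_transitive (F : fieldType) (m n : nat) (X Y : 'M[F]_(m, n)) :
  row_free X -> row_free Y -> exists2 B, B \in unitmx & X *m B = Y.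
Proof.
move=> rX rY; have le_mn : (m <= n)%N by rewrite -(eqP rX) rank_leq_col.
have [k nE] : exists k, n = (m + k)%N by exists (n - m)%N; rewrite subnKC.
rewrite {n le_mn}nE in X Y rX rY *.
have decomp (Z : 'M[F]_(m, m + k)) :
    row_free Z -> Z = col_ebase Z *m row_mx 1%:M 0 *m row_ebase Z.
  move=> /eqP rZ; rewrite -[LHS]mulmx_ebase; congr (_ *m _ *m _).
  rewrite rZ; apply/matrixP=> i j; rewrite !mxE; case: splitP => h jh.
    by rewrite !mxE ltn_ord andbT jh.
  by rewrite mxE jh ltn_ord andbT ltn_eqF // ltn_addr.
pose D := block_mx (invmx (col_ebase X) *m col_ebase Y) 0 0 (1%:M : 'M_k).
exists (invmx (row_ebase X) *m D *m row_ebase Y).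
  rewrite !unitmx_mul unitmx_inv !row_ebase_unit andbT /=.
  rewrite unitmxE det_ublock det1 mulr1 -unitmxE.
  by rewrite unitmx_mul unitmx_inv !col_ebase_unit.
rewrite {1}(decomp X rX) [RHS](decomp Y rY) !mulmxA mulmxK ?row_ebase_unit //.
rewrite -(mulmxA _ _ D); congr (_ *m _).
rewrite mul_row_block !mul1mx !mul0mx !addr0.
by rewrite !mul_mx_row mulmxA mulmxV ?col_ebase_unit // mul1mx mulmx1 !mulmx0.
Qed.

Lemma F2_cases (x : 'F_2) : x = 0 \/ x = 1.
Proof. by case: x => [[|[|x]] // ltx]; [left|right]; apply: val_inj. Qed.

(** Coefficients are only 0 or 1, so the one relation left to exclude is [a + b = 0], which means
    [a = b] in characteristic 2. *)
Lemma row_free_pair_F2 (n : nat) (a b : vec n) :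
  a != 0 -> b != 0 -> a != b -> row_free (col_mx a b).
Proof.
move=> a0 b0 ab; apply/inj_row_free => v.
rewrite -[v]hsubmxK mul_row_col [lsubmx v]mx11_scalar [rsubmx v]mx11_scalar.
rewrite !mul_scalar_mx.
case: (F2_cases (lsubmx v 0 0)) => ->; case: (F2_cases (rsubmx v 0 0)) => ->.
- by rewrite !raddf0 row_mx0.
- by rewrite scale0r add0r scale1r => /eqP; rewrite (negPf b0).
- by rewrite scale0r addr0 scale1r => /eqP; rewrite (negPf a0).
rewrite !scale1r => /eqP; rewrite addr_eq0 => /eqP abN; case/eqP: ab.
rewrite abN; apply/matrixP=> i j; rewrite mxE.
by case: (F2_cases (b i j)) => ->; apply: val_inj.
Qed.

Section SecondMoment.
Variable n : nat.
Implicit Types (f q : boolfun n) (a b : vec n) (A B : 'M['F_2]_n).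

Definition sgn f a : int := (-1) ^+ f a.

Lemma sgn_sqr f a : sgn f a ^+ 2 = 1.
Proof. exact: sqrr_sign. Qed.

Lemma qwalshE q f A : qwalsh q f A = \sum_a sgn f a * sgn q (a *m A).
Proof. by apply: eq_bigr => a _; rewrite ffunE exprD. Qed.

Lemma card_vec : #|{: vec n}| = (2 ^ n)%N.
Proof. by rewrite card_mx card_Fp // mul1n. Qed.

Lemma balanced_sum_sgn f : (0 < n)%N -> balanced f -> \sum_a sgn f a = 0.
Proof.
(* A sign is affine in its bit, which turns the sum into [2 ^ n - 2 * wt f]. *)
move=> n_gt0 bal; have -> : \sum_a sgn f a = \sum_a (1 - (f a)%:R *+ 2).
  by apply: eq_bigr => a _; rewrite /sgn; case: (f a).
rewrite sumrB sumrMnl -natr_sum sumr_const card_vec.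
have -> : (\sum_a f a)%N = wt f.
  rewrite /wt -sum1dep_card [RHS]big_mkcond.
  by apply: eq_bigr => a _; case: (f a).
rewrite bal -mulrnA -mulnC -expnS subn1 prednK //; exact: subrr.
Qed.

Definition pair_corr q a b : int :=
  \sum_(A | A \in unitmx) sgn q (a *m A) * sgn q (b *m A).

Lemma pair_corrC q a b : pair_corr q a b = pair_corr q b a.
Proof. by apply: eq_bigr => A _; rewrite mulrC. Qed.

Lemma pair_corr_diag q a : pair_corr q a a = (#|@unitmx 'F_2 n|)%:R.
Proof. by rewrite /pair_corr (eq_bigr _ (fun A _ => sgn_sqr _ _)) sumr_const. Qed.

(** Left multiplication by [B] permutes the invertible matrices. *)
Lemma pair_corr_mul q B a b :
  B \in unitmx -> pair_corr q (a *m B) (b *m B) = pair_corr q a b.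
Proof.
move=> uB; rewrite [RHS](reindex_onto (mulmx B) (mulmx (invmx B))) /=; last first.
  by move=> A _; rewrite mulKVmx.
apply: eq_big => [A|A _]; last by rewrite !mulmxA.
by rewrite unitmx_mul uB mulKmx // eqxx andbT.
Qed.

Lemma pair_corr_transitive q a b c d :
  a != 0 -> b != 0 -> a != b -> c != 0 -> d != 0 -> c != d ->
  pair_corr q a b = pair_corr q c d.
Proof.
move=> a0 b0 ab c0 d0 cd.
have [B uB] := row_free_transitive (row_free_pair_F2 a0 b0 ab)
                                   (row_free_pair_F2 c0 d0 cd).
by rewrite mul_col_mx => /eq_col_mx[<- <-]; rewrite pair_corr_mul.
Qed.

Lemma pair_corr0_transitive q a b :
  a != 0 -> b != 0 -> pair_corr q 0 a = pair_corr q 0 b.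
Proof.
move=> a0 b0; have free (c : vec n) : c != 0 -> row_free c.
  by move=> c0; rewrite /row_free rank_rV c0.
have [B uB <-] := row_free_transitive (free a a0) (free b b0).
by rewrite -(pair_corr_mul q 0 a uB) mul0mx.
Qed.

(** Here [p] is the value at distinct nonzero vectors and [t] the value when exactly one vector is
    zero. The last term is the inclusion-exclusion correction at [a = b = 0]. *)
Lemma pair_corr_form q : exists p t : int, forall a b,
  pair_corr q a b = p + (t - p) * ((a == 0)%:R + (b == 0)%:R)
    + ((#|@unitmx 'F_2 n|)%:R - p) * (a == b)%:R
    + (p - t) *+ 2 * ((a == 0) && (b == 0))%:R.
Proof.
(* The default 0 is harmless: it is taken only when no vector of the required kind exists. *)
pose t := if [pick a : vec n | a != 0] is Some a then pair_corr q 0 a else 0.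
pose p := if [pick ab : vec n * vec n | [&& ab.1 != 0, ab.2 != 0 & ab.1 != ab.2]]
  is Some ab then pair_corr q ab.1 ab.2 else 0.
have tE a : a != 0 -> pair_corr q 0 a = t.
  rewrite /t; case: pickP => [b b0 a0|/(_ a) /= -> //].
  exact: pair_corr0_transitive.
have pE a b : a != 0 -> b != 0 -> a != b -> pair_corr q a b = p.
  rewrite /p; case: pickP => [[c d] /and3P[c0 d0 cd] a0 b0 ab|/(_ (a, b)) /= + a0 b0 ab].
    exact: pair_corr_transitive.
  by rewrite a0 b0 ab.
exists p, t => a b; have [->|ab] := eqVneq a b.
  by rewrite pair_corr_diag andbb; case: (b == 0) => /=; ring.
have [a0|a0] := eqVneq a 0; have [b0|b0] := eqVneq b 0 => /=.
- by rewrite a0 b0 eqxx in ab.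
- by rewrite a0 tE //; ring.
- by rewrite b0 pair_corrC tE //; ring.
by rewrite pE //; ring.
Qed.

(** The weight [u] stays arbitrary so as to cover both [sgn f] and the constant 1. *)
Lemma sum_pair_corr q (u : vec n -> int) :
  \sum_(A | A \in unitmx) (\sum_a u a * sgn q (a *m A)) ^+ 2
  = \sum_a \sum_b u a * u b * pair_corr q a b.
Proof.
under eq_bigr => A _.
  rewrite expr2 mulr_suml; under eq_bigr => a _ do rewrite mulr_sumr.
  over.
rewrite exchange_big; apply: eq_bigr => a _.
rewrite exchange_big; apply: eq_bigr => b _.
by rewrite mulr_sumr; apply: eq_bigr => A _; ring.
Qed.

Lemma sum_delta (u : vec n -> int) b : \sum_a u a * (a == b)%:R = u b.
Proof.
rewrite (bigD1 b) //= eqxx mulr1 big1 ?addr0 // => a /negPf->.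
by rewrite mulr0.
Qed.

Lemma quadratic_form_sum (u : vec n -> int) (p s g c : int) :
  \sum_a \sum_b u a * u b * (p + s * ((a == 0)%:R + (b == 0)%:R)
      + g * (a == b)%:R + c * ((a == 0) && (b == 0))%:R)
  = p * (\sum_a u a) ^+ 2 + s * (u 0 * \sum_a u a) *+ 2
    + g * (\sum_a u a ^+ 2) + c * u 0 ^+ 2.
Proof.
set U := \sum_a u a.
have inner a : \sum_b u a * u b * (p + s * ((a == 0)%:R + (b == 0)%:R)
      + g * (a == b)%:R + c * ((a == 0) && (b == 0))%:R)
    = p * U * u a + s * U * (u a * (a == 0)%:R) + s * u 0 * u a + g * u a ^+ 2
      + c * u 0 * (u a * (a == 0)%:R).
  (* Each summand is factored into a part constant in [b] times [u b], possibly with a delta in [b],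
     ready for [sum_delta]. *)
  transitivity (\sum_b (p * u a * u b + s * (u a * (a == 0)%:R) * u b
      + s * u a * (u b * (b == 0)%:R) + g * u a * (u b * (b == a)%:R)
      + c * (u a * (a == 0)%:R) * (u b * (b == 0)%:R))).
    by apply: eq_bigr => b _; rewrite -mulnb natrM (eq_sym b a); ring.
  by rewrite !big_split /= -!mulr_sumr !sum_delta -/U; ring.
under eq_bigr => a _ do rewrite inner.
by rewrite !big_split /= -!mulr_sumr !sum_delta -/U; ring.
Qed.

Lemma sum_sgn_mul q A : A \in unitmx -> \sum_a sgn q (a *m A) = imbalance q.
Proof.
move=> uA; rewrite [RHS](reindex (mulmx^~ A)) //=.
by exists (mulmx^~ (invmx A)) => a _; rewrite ?mulmxK ?mulmxKV.
Qed.

(* Evaluating the quadratic form of [pair_corr] at the constant function 1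
   yields g I_q^2; together with the value at the mean-zero function [sgn f]
   this eliminates both unknown parameters of [pair_corr_form]. *)
Lemma second_moment_qwalsh q f : (0 < n)%N -> balanced f ->
  (2 ^+ n - 1) * \sum_(A | A \in unitmx) qwalsh q f A ^+ 2
  = (#|@unitmx 'F_2 n|)%:R * (2 ^+ (2 * n) - imbalance q ^+ 2).
Proof.
move=> n_gt0 bal; have [p [t form]] := pair_corr_form q.
move gE: (#|_|)%:R form => g form.
have quad (u : vec n -> int) : \sum_(A | A \in unitmx) (\sum_a u a * sgn q (a *m A)) ^+ 2
    = p * (\sum_a u a) ^+ 2 + (t - p) * (u 0 * \sum_a u a) *+ 2
    + (g - p) * (\sum_a u a ^+ 2) + (p - t) *+ 2 * u 0 ^+ 2.
  rewrite sum_pair_corr -quadratic_form_sum.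
  by apply: eq_bigr => a _; apply: eq_bigr => b _; rewrite form.
have sumN : \sum_(a : vec n) (1 : int) = 2 ^+ n.
  by rewrite sumr_const card_vec natrX.
(* Balancedness kills the terms containing the sum of [u]. *)
have Qf : \sum_(A | A \in unitmx) qwalsh q f A ^+ 2
    = (g - p) * 2 ^+ n + (p - t) *+ 2.
  under eq_bigr => A _ do rewrite qwalshE.
  rewrite quad balanced_sum_sgn // (eq_bigr _ (fun a _ => sgn_sqr f a)) sumN sgn_sqr.
  by rewrite expr0n /= !mulr0 mul0rn !add0r mulr1.
have Q1 : g * imbalance q ^+ 2 = p * (2 ^+ n) ^+ 2 + (t - p) * 2 ^+ n *+ 2
    + (g - p) * 2 ^+ n + (p - t) *+ 2.
  transitivity (\sum_(A | A \in unitmx) (\sum_a 1 * sgn q (a *m A)) ^+ 2).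
    rewrite -gE mulr_natl -sumr_const; apply: eq_bigr => A uA.
    by under eq_bigr => a _ do rewrite mul1r; rewrite sum_sgn_mul.
  by rewrite (quad (fun=> 1)) expr1n sumN mul1r mulr1.
(* With [N = 2 ^+ n] and [S] the value in [Qf], [Q1] amounts to
   [g * I_q ^ 2 = g * N ^ 2 - (N - 1) * S]. *)
by rewrite Qf mulrBr Q1 mulnC exprM; move: (2 ^+ n) => N; ring.
Qed.

Lemma exists_large_qwalsh q f : (0 < n)%N -> balanced f ->
  exists2 A, A \in unitmx &
    2 ^+ (2 * n) - imbalance q ^+ 2 <= (2 ^+ n - 1) * qwalsh q f A ^+ 2.
Proof.
move=> n_gt0 bal; set s := _ - _.
case: (pickP [pred A | (A \in unitmx) && (s <= (2 ^+ n - 1) * qwalsh q f A ^+ 2)]).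
  by move=> A /andP[uA leA]; exists A.
move=> small; have := second_moment_qwalsh q n_gt0 bal.
rewrite -/s mulr_sumr mulr_natl -sumr_const => /eqP; rewrite lt_eqF //.
(* A strict inequality between sums needs a nonempty range; the identity matrix provides it. *)
apply: ltr_sum => [|A uA].
  by apply/hasP; exists 1%:M; rewrite ?mem_index_enum ?unitmx1.
by have /= := small A; rewrite uA ltNge /= => ->.
Qed.

End SecondMoment.

Theorem theorem2 (R : realType) (n : nat) (q f : boolfun n) :
  (2 < n)%N ->
  nearly_bent R q f ->
  exists A0 : 'M['F_2]_n, A0 \in unitmx /\ `|qwalsh q f A0| = rho R q.
Proof.
move=> n_gt2 [bal bent]; have n_gt0 : (0 < n)%N by apply: leq_trans n_gt2.
have [A uA leA] := exists_large_qwalsh q n_gt0 bal.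
exists A; split=> //; apply/eqP; rewrite eq_le bent //=.
(* As [qwalsh q f A] is an integer, its absolute value bounds the ceiling once it bounds the root;
   writing it as the root of a square reduces this to [leA]. *)
rewrite /rho ceil_le_int.
have N1_gt0 : 0 < 2 ^+ n - 1 :> R by rewrite subr_gt0 exprn_egt1 ?ltr1n // -lt0n.
rewrite intr_norm -sqrtr_sqr ler_sqrt ?sqr_ge0 // ler_pdivrMr // mulrC.
by move: leA; rewrite -(ler_int R) !(rmorphB, rmorphM, rmorphXn).
Qed.
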